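(* Suppose $m\ge 1$ is an integer and $\alpha,\nu\in[0,1)$. Then, for $n\in\mathbb{N}$ with $n\alpha\ge\nu$, $$\mathcal{N}_{n,\alpha,\nu,1,m} = \frac{-\alpha n}{1-\alpha}+n\int_0^1\frac{(1-x)x^{-\alpha}}{1-x^m}\,dx + O\left(\sqrt{n}\right),$$ and, for every integer $r$ with $2\le r\le m$, $$\mathcal{N}_{n,\alpha,\nu,r,m} = n\int_0^1\frac{(1-x)x^{r-1-\alpha}}{1-x^m}\,dx + O\left(\sqrt{n}\right).$$
   Context: $\mathbb{N}$ denotes the set of positive integers and $\lfloor\cdot\rfloor$ the floor function. For $n,m\in\mathbb{N}$, $r\in\mathbb{Z}$ and $\alpha,\nu\in\mathbb{R}$, define $$\mathcal{N}_{n,\alpha,\nu,r,m}=\#\left\{k\in\mathbb{Z} : 1\le k\le n,\ \left\lfloor\frac{n-\nu}{k}+\alpha\right\rfloor\equiv r \pmod m\right\}.$$ Big O notation: $f(n)=O(g(n))$ means there exist constants $M$ and $a$ such that $|f(n)|\le M g(n)$ for all $n\ge a$ (in the range of $n$ under consideration). Here everything is regarded as a function of $n$, with $\alpha,\nu,r,m$ fixed. *)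

(* Defs.v *)
From mathcomp Require Import all_boot all_order all_algebra.
From mathcomp Require Import all_classical all_reals all_analysis.
Import Order.TTheory GRing.Theory Num.Theory.
Import numFieldNormedType.Exports.

Set Implicit Arguments.
Unset Strict Implicit.
Unset Printing Implicit Defensive.

Local Open Scope classical_set_scope.
Local Open Scope ring_scope.

Definition floor_count (R : realType) (n : nat) (alpha nu : R) (r : int)
    (m : nat) : nat :=
  #|[set k : 'I_n.+1 | (1 <= k)%N &&
      (Num.floor ((n%:R - nu) / k%:R + alpha) == r %[mod m])%Z]%SET|.

(* The range of [n] under consideration.  When [alpha = 0 < nu] it is empty,
   and any asymptotic estimate along [within (admissible alpha nu) \oo] is then
   vacuous. *)
Definition admissible (R : realType) (alpha nu : R) : set nat :=
  [set n | (1 <= n)%N /\ nu <= n%:R * alpha].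

(* Main.v *)
(* For q >= 1, floor((n - nu)/k + alpha) >= q iff k <= (n - nu)/(q - alpha), so
   about n/(q - alpha) of the k in [1, n] reach level q; only at q = 1 does the
   constraint k <= n bind (this is where n alpha >= nu enters), which produces
   the correction n - n/(1 - alpha).  Counting exactly the J values
   q = r + j m, j < J, costs an error O(1) each, while the k with value at least
   r + J m number at most n/J.  On the integral side, expanding
   1/(1 - x^m) up to order J yields the matching sum of
   1/(q - alpha) - 1/(q + 1 - alpha), with remainder at most
   \int x^(r + J m - 1 - alpha) <= 1/J.  Taking J of order sqrt n balances the
   two errors. *)
Require Import Defs.
From mathcomp Require Import all_boot all_order all_algebra.
From mathcomp Require Import all_classical all_reals all_analysis.
From mathcomp Require Import measurable_realfun ring lra zify.
Import Order.TTheory GRing.Theory Num.Theory.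
Import numFieldNormedType.Exports.

Local Open Scope classical_set_scope.
Local Open Scope ring_scope.

(** * Integrals of real powers over the unit interval *)

(** For negative [s] the integrand is unbounded near 0, so the fundamental theorem of calculus is
    applied on [[u i, 1]], and monotone convergence lets [u i] decrease to 0. *)
Lemma integral_powR01 {R : realType} (s : R) : -1 < s ->
  (\int[lebesgue_measure]_(x in `[0%R, 1%R]) (x `^ s)%:E = ((s + 1)^-1)%:E)%E.
Proof.
move=> hs; have s1 : 0 < s + 1 by lra.
(* Starting at 1/2 keeps [u i < 1], so every interval is nondegenerate. *)
pose u (i : nat) : R := i.+2%:R^-1.
have u_gt0 i : 0 < u i by rewrite /u invr_gt0.
have u_lt1 i : u i < 1 by rewrite /u invf_lt1// ltr1n.
have u_cvg0 : u i @[i --> \oo] --> (0 : R).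
  by rewrite (cvg_shiftS (@harmonic R)); exact: cvg_harmonic.
have mpow (D : set R) : measurable_fun D (EFin \o (fun x : R => x `^ s)).
  apply/measurable_EFinP; apply: measurable_funS (measurable_powR s) => //.
rewrite -integral_itv_obnd_cbnd; last exact: mpow.
have -> : `]0%R, 1%R]%classic = \bigcup_i `[u i, 1%R]%classic :> set R.
  apply/seteqP; split=> x /=; last first.
    by case=> i _ /=; rewrite !in_itv/= => /andP[ux ->]; rewrite (lt_le_trans (u_gt0 i)).
  rewrite in_itv/= => /andP[x0 x1].
  have [i _ /= Hi] : exists2 i, True & u i <= x.
    have /cvgrPdist_lt/(_ _ x0)[i _ /(_ i (leqnn _))] := u_cvg0.
    by rewrite /= sub0r normrN gtr0_norm// => /ltW; exists i.
  by exists i => //=; rewrite in_itv/= Hi.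
have ndF : nondecreasing_seq (fun i => `[u i, 1%R]%classic : set R).
  move=> i j ij; apply/subsetPset => x /=; rewrite !in_itv/= => /andP[ux ->].
  by rewrite (le_trans _ ux)// /u lef_pV2 ?posrE// ler_nat !ltnS.
have icvg : (\int[lebesgue_measure]_(x in `[u i, 1%R]%classic) (x `^ s)%:E @[i --> \oo] -->
    \int[lebesgue_measure]_(x in \bigcup_i `[u i, 1%R]%classic) (x `^ s)%:E)%E.
  apply: ge0_nondecreasing_set_cvg_integral => // [i|i x _]; first exact: mpow.
  by rewrite lee_fin powR_ge0.
pose G : R -> R := (s + 1)^-1 \*: (@powR R ^~ (s + 1)).
have dG (x : R) : 0 < x -> is_derive x 1 G (x `^ s).
  move=> x0; have := is_deriveZ (s + 1)^-1 (is_derive1_powR (s + 1) x0).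
  by rewrite addrK /GRing.scale/= mulKf ?gt_eqF.
have cG (x : R) : 0 < x -> {for x, continuous G}.
  by move=> /dG h; apply/differentiable_continuous/derivable1_diffP; exact: ex_derive.
have ftc i : (\int[lebesgue_measure]_(x in `[u i, 1%R]%classic) (x `^ s)%:E =
    (G 1 - G (u i))%:E)%E.
  rewrite (@continuous_FTC2 _ _ G) ?EFinB//.
  - apply: continuous_in_subspaceT => x /set_mem/=; rewrite in_itv/= => /andP[ux _].
    have x0 := lt_le_trans (u_gt0 i) ux.
    apply/differentiable_continuous/derivable1_diffP/derivable_powR.
    by rewrite in_itv/= x0.
  - split.
    + move=> x; rewrite in_itv/= => /andP[ux _].
      by have h := dG _ (lt_trans (u_gt0 i) ux); exact: ex_derive.
    + by apply: cvg_at_right_filter; exact: cG.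
    + by apply: cvg_at_left_filter; exact: cG.
  - move=> x; rewrite in_itv/= => /andP[ux _]; have h := dG _ (lt_trans (u_gt0 i) ux).
    by rewrite derive1E; exact: derive_val.
(* Since [s + 1 > 0], the primitive contributes nothing at 0. *)
have Gu : G (u i) @[i --> \oo] --> (0 : R).
  rewrite -[X in _ --> X](mulr0 (s + 1)^-1); apply: cvgMr.
  by move/cvg_at_rightP: (powR_cvg0 s1); apply; split.
have {icvg} : (fun i => (G 1 - G (u i))%:E) @ \oo -->
    (\int[lebesgue_measure]_(x in \bigcup_i `[u i, 1%R]%classic) (x `^ s)%:E)%E.
  by under eq_fun do rewrite -ftc.
move=> /cvg_unique; apply => //.
apply/cvg_EFin; first exact: nearW.
rewrite [X in _ --> X](_ : _ = G 1 - 0); first exact: cvgB (cvg_cst _) Gu.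
by rewrite subr0 /G/= powR1 /GRing.scale/= mulr1.
Qed.

Lemma integrable_powR01 {R : realType} {s : R} : -1 < s ->
  lebesgue_measure.-integrable `[0%R, 1%R]%classic (EFin \o (@powR R ^~ s)).
Proof.
move=> hs; apply/integrableP; split.
  apply/measurable_EFinP; apply: measurable_funS (measurable_powR s) => //.
under eq_integral do rewrite /= ger0_norm ?powR_ge0//.
by rewrite integral_powR01// ltry.
Qed.

Lemma Rintegral_powR01 {R : realType} {s : R} : -1 < s ->
  \int[lebesgue_measure]_(x in `[0, 1]) (x `^ s) = (s + 1)^-1.
Proof. by move=> hs; rewrite /Rintegral integral_powR01. Qed.

(** * The integrand and its expansion *)

Definition kernel_frac {R : realType} (m : nat) (s x : R) : R :=
  (1 - x) * x `^ s / (1 - x ^+ m).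

(** As [x ^+ m <= x] on the unit interval, the factor [(1 - x) / (1 - x ^+ m)] is at most 1; at
    [x = 1] it is 0 because the numerator vanishes. *)
Lemma kernel_frac_bounds {R : realType} {m : nat} (s : R) {x : R} :
  (0 < m)%N -> 0 <= x <= 1 -> 0 <= kernel_frac m s x <= x `^ s.
Proof.
move=> m0 /andP[x0 x1]; rewrite /kernel_frac.
have [->|x1'] := eqVneq x 1; first by rewrite subrr !mul0r lexx powR_ge0.
have xlt1 : x < 1 by rewrite lt_neqAle x1'.
have xm : x ^+ m <= x by rewrite ler_iXnr ?x0.
have ps := powR_ge0 x s.
have d0 : 0 < 1 - x ^+ m by lra.
by rewrite divr_ge0 ?mulr_ge0 ?ler_pdivrMr//=; nra.
Qed.

(** One step of the geometric series: 1/(1 - x^m) = 1 + x^m/(1 - x^m), multiplied by (1 - x) x^s. *)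
Lemma kernel_frac_shift {R : realType} {m : nat} (s : R) {x : R} :
  (0 < m)%N -> -1 < s -> 0 <= x <= 1 ->
  kernel_frac m s x = x `^ s - x `^ (s + 1) + kernel_frac m (s + m%:R) x.
Proof.
move=> m0 hs /andP[x0 x1]; rewrite /kernel_frac.
have [->|x1'] := eqVneq x 1; first by rewrite !powR1 !subrr !mul0r addr0.
have xlt1 : x < 1 by rewrite lt_neqAle x1'.
have d0 : 1 - x ^+ m != 0 by have := ler_iXnr m0 x0 x1; lra.
have m1 : 1 <= m%:R :> R by rewrite ler1n.
(* At 0 the powers are evaluated directly: [s + 1] and [s + m%:R] are positive, so both of these
   powers vanish. *)
have [->|xn0] := eqVneq x 0.
  rewrite [0 `^ (s + 1)]powR0; last lra.
  rewrite [0 `^ (s + m%:R)]powR0; last lra.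
  by rewrite expr0n gtn_eqF//=; field.
rewrite !powRD ?xn0 ?implybT// powRr1// powR_mulrn//.
by field.
Qed.

Lemma integrable_kernel_frac {R : realType} {m : nat} {s : R} :
  (0 < m)%N -> -1 < s ->
  lebesgue_measure.-integrable `[0%R, 1%R]%classic (EFin \o kernel_frac m s).
Proof.
move=> m0 hs.
apply: le_integrable (integrable_powR01 hs) => //.
  apply/measurable_EFinP.
  rewrite (_ : kernel_frac m s =
    (fun x => (1 - x) * x `^ s) \* (fun x => (1 - x ^+ m)^-1)) //.
  apply: measurable_funM.
    apply: measurable_funM; first exact: measurable_funB.
    by apply: measurable_funS (measurable_powR s).
  (* The base is nonnegative here, so the inverse is a real power, whose measurability is known. *)
  apply: (@eq_measurable_fun _ _ _ _ _ (fun x : R => (1 - x ^+ m) `^ (-1))).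
    move=> x /set_mem/=; rewrite in_itv/= => /andP[x0 x1].
    by rewrite powR_inv1// subr_ge0 exprn_ile1.
  apply: (measurableT_comp (measurable_powR (-1))).
  by apply: measurable_funB => //; exact: exprn_measurable.
move=> x /=; rewrite in_itv/= => x01.
have /andP[h0 h1] := kernel_frac_bounds s m0 x01.
by rewrite lee_fin !ger0_norm// powR_ge0.
Qed.

Lemma Rintegral_kernel_frac_bounds {R : realType} {m : nat} {s : R} :
  (0 < m)%N -> -1 < s ->
  0 <= \int[lebesgue_measure]_(x in `[0, 1]) kernel_frac m s x <= (s + 1)^-1.
Proof.
move=> m0 hs; apply/andP; split.
  by apply: Rintegral_ge0 => x /=; rewrite in_itv/= => /(kernel_frac_bounds s m0)/andP[].
rewrite -Rintegral_powR01//; apply: le_Rintegral => //.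
- exact: integrable_kernel_frac.
- exact: integrable_powR01.
- by move=> x /=; rewrite in_itv/= => /(kernel_frac_bounds s m0)/andP[].
Qed.

(** [kernel_frac_shift] iterated [J] times. For s = r - 1 - alpha the summand is 1/(q - alpha) -
    1/(q + 1 - alpha) with q = r + j m. *)
Lemma Rintegral_kernel_frac {R : realType} {m : nat} (J : nat) {s : R} :
  (0 < m)%N -> -1 < s ->
  \int[lebesgue_measure]_(x in `[0, 1]) kernel_frac m s x =
  \sum_(j < J) ((s + (j * m)%:R + 1)^-1 - (s + (j * m)%:R + 2)^-1) +
  \int[lebesgue_measure]_(x in `[0, 1]) kernel_frac m (s + (J * m)%:R) x.
Proof.
move=> m0 hs; elim: J => [|J ->]; first by rewrite big_ord0 add0r mul0n addr0.
rewrite big_ord_recr/= -addrA; congr (_ + _).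
have := ler0n R (J * m)%N; set t := s + _ => t0.
have ht : -1 < t by rewrite /t; lra.
have := @integrable_kernel_frac R m (t + m%:R) m0.
have -> : s + (J.+1 * m)%:R = t + m%:R by rewrite /t mulSnr natrD addrA.
have := ler0n R m.
move=> m0' /(_ ltac:(lra)) i3.
have i1 := integrable_powR01 ht; have i2 := @integrable_powR01 R (t + 1) ltac:(lra).
have -> : \int[lebesgue_measure]_(x in `[0, 1]) kernel_frac m t x =
    \int[lebesgue_measure]_(x in `[0, 1])
      ((x `^ t - x `^ (t + 1)) + kernel_frac m (t + m%:R) x).
  by apply: eq_Rintegral => x /set_mem/=; rewrite in_itv/= => /(kernel_frac_shift _ m0 ht).
rewrite RintegralD//; last first.
  have := integrableB _ i1 i2.
  by apply.
rewrite RintegralB// !Rintegral_powR01//; last by lra.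
by rewrite -[t + 1 + 1]addrA.
Qed.

(** * Sums of threshold indicators *)

(** The sum is exactly the integer part of [x], because [x <= n%:R] keeps the range from cutting it
    off. *)
Lemma sum_le_bounds {R : realType} {n : nat} {x : R} : 0 <= x <= n%:R ->
  x - 1 <= \sum_(k < n) (k.+1%:R <= x)%R%:R <= x.
Proof.
move=> /andP[x0 xn].
have -> : \sum_(k < n) (k.+1%:R <= x)%R%:R = (Num.truncn x)%:R :> R.
  have tn : (Num.truncn x <= n)%N by rewrite -(@ler_nat R) (le_trans _ xn)// truncn_le.
  under eq_bigr => k _ do rewrite -truncn_gt_nat.
  rewrite -natr_sum; congr _%:R.
  transitivity (\sum_(k < n | (k < Num.truncn x)%N) 1)%N.
    by rewrite [RHS]big_mkcond/=; apply: eq_bigr => k _; case: ltnP.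
  by rewrite -(big_ord_widen _ (fun=> 1%N) tn) sum1_card card_ord.
by have /andP[] := truncn_itv x0; rewrite -natr1; lra.
Qed.

(** Each difference of indicators singles out v = r + j m; the last term collects the larger members
    of the residue class. *)
Lemma indicator_mod_telescope {R : pzRingType} {m r : nat} (J : nat) {v : int} :
  (1 <= r <= m)%N -> 1 <= v ->
  (v == r %[mod m])%Z%:R =
    \sum_(j < J) (((r + j * m)%N%:Z <= v)%R%:R - ((r + j * m).+1%:Z <= v)%R%:R)
    + ((v == r %[mod m])%Z && ((r + J * m)%N%:Z <= v)%R)%:R :> R.
Proof.
move=> /andP[r1 rm] v1.
elim: J => [|J ->].
  rewrite big_ord0 add0r mul0n addn0; case: eqP => //= /eqP.
  rewrite eqz_mod_dvd => /dvdzP[c vc].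
  suff -> : (r%:Z <= v) by [].
  (* Here v = r + c m, and a negative [c] would force v <= r - m <= 0. *)
  have [c0|c0] : 0 <= c \/ c <= -1 by lia.
    by nia.
  by nia.
rewrite big_ord_recr/= -!addrA; congr (_ + _).
case: eqP => /= [/eqP|nvr].
  rewrite eqz_mod_dvd => /dvdzP[c vc].
  have [h|h] := leP (r + J * m)%N%:Z v; last first.
    have -> : ((r + J * m).+1%:Z <= v) = false by lia.
    have -> : ((r + J.+1 * m)%N%:Z <= v) = false by lia.
    by rewrite addNKr.
  have [hv|hv] := eqVneq v (r + J * m)%N%:Z.
    have -> : ((r + J * m).+1%:Z <= v) = false by lia.
    have -> : ((r + J.+1 * m)%N%:Z <= v) = false by lia.
    by rewrite !mulr0n addr0 subr0.
  have -> : ((r + J * m).+1%:Z <= v) by lia.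
  suff -> : ((r + J.+1 * m)%N%:Z <= v) by rewrite addNKr.
  have [c0|c0] : c <= J \/ J.+1%:Z <= c by lia.
    by nia.
  by nia.
rewrite addr0; suff -> : ((r + J * m)%N%:Z <= v) = ((r + J * m).+1%:Z <= v) by rewrite subrr.
apply/idP/idP => h; last lia.
suff : v != (r + J * m)%N%:Z by lia.
apply/eqP => vE; apply: nvr; apply/eqP; rewrite eqz_mod_dvd; apply/dvdzP.
by exists J%:Z; lia.
Qed.

(** * Counting the integers that reach a given level *)

(** The divisor is [k.+1], so that [k < n] covers the divisors from 1 to [n]. *)
Definition level {R : realType} (n : nat) (alpha nu : R) (k : nat) : int :=
  Num.floor ((n%:R - nu) / k.+1%:R + alpha).

Definition level_count {R : realType} (n : nat) (alpha nu : R) (q : nat) : R :=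
  \sum_(k < n) (q%:Z <= level n alpha nu k)%R%:R.

Lemma floor_countE {R : realType} (n : nat) (alpha nu : R) (r : int) (m : nat) :
  (floor_count n alpha nu r m)%:R =
  \sum_(k < n) (level n alpha nu k == r %[mod m])%Z%:R :> R.
Proof.
rewrite /floor_count -sum1_card -natr_sum; congr _%:R.
rewrite big_mkcond/= big_ord_recl/= inE/= add0n.
by apply: eq_bigr => k _; rewrite inE /= /level /=; case: (Num.floor _ == _ %[mod _])%Z.
Qed.

Lemma le_level {R : realType} {alpha nu : R} {n : nat} (q k : nat) :
  alpha < 1 -> (0 < q)%N ->
  (q%:Z <= level n alpha nu k) = (k.+1%:R <= (n%:R - nu) / (q%:R - alpha)).
Proof.
move=> a1 q0; have q1 : 1 <= q%:R :> R by rewrite ler1n.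
have k0 : 0 < k.+1%:R :> R by [].
have d0 : 0 < q%:R - alpha by lra.
by rewrite /level floor_ge_int ler_pdivlMr// -lerBlDr ler_pdivlMr// mulrC.
Qed.

(** Admissibility gives n (1 - alpha) <= n - nu, so even the divisor [n] reaches level 1. *)
Lemma level_ge1 {R : realType} {alpha nu : R} {n : nat}
    (halpha : 0 <= alpha < 1) (hnu : 0 <= nu < 1) (hn : admissible alpha nu n)
    {k : nat} : (k < n)%N -> 1 <= level n alpha nu k.
Proof.
move=> kn; have a1 : alpha < 1 by lra.
rewrite (le_level 1)// ler_pdivlMr ?subr_gt0//.
have kn' : k.+1%:R <= n%:R :> R by rewrite ler_nat.
have [_ /= hna] := hn.
by apply: le_trans (_ : n%:R * (1 - alpha) <= _); [rewrite ler_wpM2r// subr_ge0 ltW|lra].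
Qed.

Lemma level_count1 {R : realType} {alpha nu : R} {n : nat}
    (halpha : 0 <= alpha < 1) (hnu : 0 <= nu < 1) (hn : admissible alpha nu n) :
  level_count n alpha nu 1 = n%:R.
Proof.
rewrite /level_count (eq_bigr (fun=> 1)) ?sumr_const ?card_ord//.
by move=> k _; rewrite (level_ge1 halpha hnu hn).
Qed.

(** For [q >= 2] the denominator exceeds 1, so the threshold stays below [n]. The loss of 2 is 1
    from the integer part and at most 1 from nu/(q - alpha). *)
Lemma level_count_bounds {R : realType} {alpha nu : R} {n : nat}
    (halpha : 0 <= alpha < 1) (hnu : 0 <= nu < 1) (hn : (1 <= n)%N)
    {q : nat} : (1 < q)%N ->
  n%:R / (q%:R - alpha) - 2 <= level_count n alpha nu q <= n%:R / (q%:R - alpha).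
Proof.
move=> q1; have q2 : 2 <= q%:R :> R by rewrite ler_nat.
have d0 : 0 < q%:R - alpha by lra.
have n1 : 1 <= n%:R :> R by rewrite ler1n.
have xn : 0 <= (n%:R - nu) / (q%:R - alpha) <= n%:R.
  by rewrite divr_ge0 ?ler_pdivrMr//=; nra.
have -> : level_count n alpha nu q =
    \sum_(k < n) (k.+1%:R <= (n%:R - nu) / (q%:R - alpha))%R%:R.
  have a1 : alpha < 1 by lra.
  by apply: eq_bigr => k _; rewrite (le_level _ _ a1 (ltnW q1)).
have /andP[h1 h2] := sum_le_bounds xn.
have : 0 <= nu / (q%:R - alpha) <= 1.
  by rewrite divr_ge0 ?ler_pdivrMr//=; lra.
by move: h1 h2; rewrite mulrBl; lra.
Qed.

(* The bound [k <= n] truncates level 1 from [n / (1 - alpha)] down to [n]. *)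
Definition level_main {R : realType} (n : nat) (alpha : R) (q : nat) : R :=
  n%:R / (q%:R - alpha) + (q == 1%N)%:R * (n%:R - n%:R / (1 - alpha)).

Lemma level_mainP {R : realType} {alpha nu : R} {n : nat}
    (halpha : 0 <= alpha < 1) (hnu : 0 <= nu < 1) (hn : admissible alpha nu n)
    {q : nat} : (0 < q)%N ->
  `|level_count n alpha nu q - level_main n alpha q| <= 2.
Proof.
have n1 : (1 <= n)%N by case: hn.
rewrite /level_main leq_eqVlt eq_sym => /predU1P[->|].
  by rewrite eqxx (level_count1 halpha hnu hn) mul1r addrCA !subrr addr0 subrr normr0.
move=> q1; rewrite gtn_eqF// mul0r addr0 ler_norml.
by have := level_count_bounds halpha hnu n1 q1; lra.
Qed.

(** * Comparing the count with the integral *)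

(** Each of the [J] differences involves two level counts, each off by at most 2, hence [4 * J%:R].
    Both remainders lie between 0 and [n%:R / J%:R], so their difference costs that bound only
    once. *)
Lemma floor_count_approx {R : realType} {alpha nu : R} {n : nat}
    (halpha : 0 <= alpha < 1) (hnu : 0 <= nu < 1) (hn : admissible alpha nu n)
    {m r J : nat} : (0 < J)%N -> (1 <= r <= m)%N ->
  `|(floor_count n alpha nu r m)%:R -
     ((r == 1%N)%:R * (n%:R - n%:R / (1 - alpha)) +
      n%:R * \int[lebesgue_measure]_(x in `[0, 1])
        kernel_frac m (r%:R - 1 - alpha) x)| <= 4 * J%:R + n%:R / J%:R.
Proof.
have n1 : (1 <= n)%N by case: hn.
move=> J0 rm; have /andP[r1 rlem] := rm; have m0 : (0 < m)%N by lia.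
have r1R : 1 <= r%:R :> R by rewrite ler1n.
have hs : -1 < r%:R - 1 - alpha by lra.
set q := fun j => (r + j * m)%N.
have q0 j : (0 < q j)%N by rewrite /q; lia.
set rest := \sum_(k < n)
  ((level n alpha nu k == r %[mod m])%Z && ((q J)%:Z <= level n alpha nu k)%R)%:R : R.
have -> : (floor_count n alpha nu r m)%:R = 
    \sum_(j < J) (level_count n alpha nu (q j) - level_count n alpha nu (q j).+1) + rest.
  rewrite floor_countE; under [X in _ = X + _]eq_bigr do rewrite -sumrB.
  rewrite exchange_big/= -big_split/=; apply: eq_bigr => k _.
  by rewrite (indicator_mod_telescope J rm (level_ge1 halpha hnu hn (ltn_ord k))).
have qJ : (1 < q J)%N by rewrite /q; nia.
have rest_bounds : 0 <= rest <= n%:R / ((q J)%:R - alpha).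
  have /andP[_ h] := level_count_bounds halpha hnu n1 qJ.
  rewrite sumr_ge0//= (le_trans _ h)// ler_sum// => k _.
  by case: (_ == _ %[mod _])%Z.
rewrite (Rintegral_kernel_frac J m0 hs).
set rem := \int[_]_(x in _) _.
have rem_bounds : 0 <= n%:R * rem <= n%:R / ((q J)%:R - alpha).
  have := @Rintegral_kernel_frac_bounds R m (r%:R - 1 - alpha + (J * m)%:R) m0.
  rewrite -/rem (_ : _ + 1 = (q J)%:R - alpha); last by rewrite /q natrD; ring.
  have := ler0n R (J * m) => Jm0 /(_ ltac:(lra)) /andP[h1 h2].
  by rewrite mulr_ge0//= ler_wpM2l.
have J1 : 1 <= J%:R :> R by rewrite ler1n.
have tail_le : n%:R / ((q J)%:R - alpha) <= n%:R / J%:R.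
  have le_J : J%:R <= (q J)%:R - alpha.
    have : 1 <= m%:R :> R by rewrite ler1n.
    by rewrite /q natrD natrM; nra.
  have J_gt0 : 0 < J%:R :> R by rewrite ltr0n.
  by rewrite ler_wpM2l// lef_pV2// posrE// (lt_le_trans J_gt0).
set c := n%:R - n%:R / (1 - alpha).
have -> : (r == 1%N)%:R * c +
    n%:R * (\sum_(j < J) ((r%:R - 1 - alpha + (j * m)%:R + 1)^-1 -
                          (r%:R - 1 - alpha + (j * m)%:R + 2)^-1) + rem) =
    \sum_(j < J) (level_main n alpha (q j) - level_main n alpha (q j).+1) + n%:R * rem.
  rewrite [n%:R * _]mulrDr addrA; congr (_ + _); rewrite mulr_sumr.
  (* Level 1 occurs among the [q j] only for [j = 0] and [r = 1]; [J > 0] ensures that this term is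
     present. *)
  have -> : (r == 1%N)%:R * c = \sum_(j < J) (q j == 1%N)%:R * c.
    case: J J0 {rest rest_bounds rem rem_bounds tail_le qJ J1} => // J _.
    rewrite big_ord_recl/= /q mul0n addn0 big1 ?addr0// => j _.
    by rewrite (_ : _ == _ = false) ?mul0r//; apply/negbTE; rewrite /bump/=; nia.
  rewrite -big_split/=; apply: eq_bigr => j _.
  rewrite /level_main eqSS (gtn_eqF (q0 j)) mul0r addr0 -/c /q -[(r + j * m).+1%:R]natr1 natrD.
  rewrite (_ : _ + 1 = r%:R + (j * m)%:R - alpha); last by ring.
  rewrite (_ : _ + 2 = r%:R + (j * m)%:R + 1 - alpha); last by ring.
  ring.
have : `|\sum_(j < J) (level_count n alpha nu (q j) - level_count n alpha nu (q j).+1)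
   - \sum_(j < J) (level_main n alpha (q j) - level_main n alpha (q j).+1)| <= 4 * J%:R.
  rewrite -sumrB (le_trans (ler_norm_sum _ _ _))//.
  rewrite (_ : 4 * J%:R = \sum_(j < J) 4); last by rewrite sumr_const card_ord mulr_natr.
  apply: ler_sum => j _.
  have := level_mainP halpha hnu hn (q0 j); have := level_mainP halpha hnu hn (ltn0Sn (q j)).
  by rewrite !ler_norml; lra.
by rewrite !ler_norml; lra.
Qed.

(** With s the square root of [n], take J = truncn s + 1: then s < J <= s + 1, and 4 J + n/J <= 5 s
    + 4 <= 9 s because s >= 1. *)
Lemma floor_count_approx_sqrt {R : realType} {alpha nu : R} {n : nat}
    (halpha : 0 <= alpha < 1) (hnu : 0 <= nu < 1) (hn : admissible alpha nu n)
    {m r : nat} : (1 <= r <= m)%N ->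
  `|(floor_count n alpha nu r m)%:R -
     ((r == 1%N)%:R * (n%:R - n%:R / (1 - alpha)) +
      n%:R * \int[lebesgue_measure]_(x in `[0, 1])
        kernel_frac m (r%:R - 1 - alpha) x)| <= 9 * Num.sqrt n%:R.
Proof.
have n1 : (1 <= n)%N by case: hn.
move=> rm; set s : R := Num.sqrt n%:R.
have s0 : 0 <= s by exact: sqrtr_ge0.
have sE : s ^+ 2 = n%:R by rewrite sqr_sqrtr.
have s1 : 1 <= s by rewrite -sqrtr1 ler_wsqrtr ?ler1n.
have /andP[tl tu] := truncn_itv s0.
apply: le_trans (floor_count_approx halpha hnu hn (ltn0Sn (Num.truncn s)) rm) _.
have : n%:R / (Num.truncn s).+1%:R <= s.
  by rewrite ler_pdivrMr// -sE expr2 ler_wpM2l// ltW.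
by rewrite -natr1; lra.
Qed.

Theorem theorem4p12 (R : realType) (m : nat) (alpha nu : R)
    (hm : (1 <= m)%N) (halpha : 0 <= alpha < 1) (hnu : 0 <= nu < 1) :
  (fun n : nat => (floor_count n alpha nu 1 m)%:R : R) =
    (fun n : nat =>
       - alpha * n%:R / (1 - alpha)
       + n%:R * (\int[lebesgue_measure]_(x in `[0, 1])
                   ((1 - x) * x `^ (- alpha) / (1 - x ^+ m))))
    +O_ (within (admissible alpha nu) \oo) (fun n : nat => Num.sqrt (n%:R : R))
  /\
  forall r : int, 2 <= r <= m%:Z ->
    (fun n : nat => (floor_count n alpha nu r m)%:R : R) =
      (fun n : nat =>
         n%:R * (\int[lebesgue_measure]_(x in `[0, 1])
                   ((1 - x) * x `^ (r%:~R - 1 - alpha) / (1 - x ^+ m))))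
      +O_ (within (admissible alpha nu) \oo) (fun n : nat => Num.sqrt (n%:R : R)).
Proof.
have bigO_of_le (f g : nat -> R) :
    (forall n, admissible alpha nu n -> `|f n - g n| <= 9 * Num.sqrt n%:R) ->
    f = g +O_ (within (admissible alpha nu) \oo) (fun n : nat => Num.sqrt (n%:R : R)).
  move=> fg; apply/eqaddOP.
  (* Every constant [C >= 9] works, at all admissible [n] and not only at large ones. *)
  apply: filterS (nbhs_pinfty_ge (num_real (9 : R))) => C hC.
  rewrite nearE /within/=; apply: nearW => n /fg /le_trans; apply.
  by rewrite [`|Num.sqrt _|]ger0_norm ?sqrtr_ge0// ler_wpM2r ?sqrtr_ge0.
split=> [|r].
  apply: bigO_of_le => n hn.
  have := floor_count_approx_sqrt halpha hnu hn (m := m) (r := 1).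
  rewrite hm => /(_ isT); rewrite mul1r subrr sub0r /kernel_frac.
  rewrite (_ : - alpha * n%:R / (1 - alpha) = n%:R - n%:R / (1 - alpha))//.
  by field; lra.
case: r => // r /andP[r2 rm]; apply: bigO_of_le => n hn.
have := floor_count_approx_sqrt halpha hnu hn (m := m) (r := r).
rewrite (_ : (1 <= r <= m)%N); last lia.
by move=> /(_ isT); rewrite gtn_eqF ?mul0r ?add0r//; lia.
Qed.
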